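(* Let $\mathbf P=(P,\le)$ and $\mathbf Q=(Q,\le)$ be posets, let $(f,f^* )$ be a pair of operator-residuated mappings between $\mathbf P$ and $\mathbf Q$, and let $a\in P$ and $b\in Q$. Then (i) $f(a)\le_1 f\big(f^*(f(a))\big)$ and $f\big(f^*(f(a))\big)\le f(a)$; (ii) $f^*(b)\le_1 f^*\big(f(f^*(b))\big)$ and $f^*\big(f(f^*(b))\big)\le_1 f^*(b)$.
   Context: Singletons are identified with their unique element. For subsets $A,B$ of a poset: $A\le B$ means $x\le y$ for all $x\in A$ and all $y\in B$; $A\le_1 B$ means that for every $x\in A$ there is some $y\in B$ with $x\le y$. An antichain is a subset in which any two different elements are incomparable; $\mathbb A(\mathbf P)$ denotes the set of all non-empty antichains of $\mathbf P$. A pair of operator-residuated mappings between $\mathbf P$ and $\mathbf Q$ is a pair $(f,f^* )$ with $f\colon P\to Q$ and $f^*\colon Q\to\mathbb A(\mathbf P)$ such that for all $x\in P$ and all $y\in Q$: $f(x)\le y$ if and only if $x\le_1 f^*(y)$ (i.e. there is $z\in f^*(y)$ with $x\le z$). The mappings are extended to subsets by unions: for $C\subseteq P$, $f(C):=\{f(x)\mid x\in C\}$, and for $D\subseteq Q$, $f^*(D):=\bigcup_{y\in D}f^*(y)$. *)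

(* Defs.v *)
From mathcomp Require Import all_boot all_order.
From mathcomp Require Import boolp classical_sets.

Set Implicit Arguments.
Unset Strict Implicit.
Unset Printing Implicit Defensive.

Import Order.TTheory.

Local Open Scope classical_set_scope.
Local Open Scope order_scope.

Section SetOrders.
Context {d : Order.disp_t} {P : porderType d}.
Implicit Types A B : set P.

Definition set_le A B : Prop := forall x y, A x -> B y -> x <= y.

Definition set_le1 A B : Prop := forall x, A x -> exists2 y, B y & x <= y.

Definition antichain A : Prop := forall x y, A x -> A y -> x <> y -> x >< y.

Definition antichains : set (set P) := [set A | A !=set0 /\ antichain A].

End SetOrders.

Arguments antichains {d} P.

Section OperatorResiduated.
Context {dP dQ : Order.disp_t} {P : porderType dP} {Q : porderType dQ}.

(* Elements of a poset are turned into singletons where a subset is expected *)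
Definition operator_residuated (f : P -> Q) (fs : Q -> set P) : Prop :=
  (forall y, antichains P (fs y)) /\
  (forall x y, f x <= y <-> set_le1 [set x] (fs y)).

(* The extension of [fs] to subsets by unions;
   that of [f] is the direct image [f @` C]. *)
Definition set_ext (fs : Q -> set P) (D : set Q) : set P :=
  \bigcup_(y in D) fs y.

End OperatorResiduated.

(* Main.v *)
Require Import Defs.
From mathcomp Require Import all_boot all_order.
From mathcomp Require Import boolp classical_sets.

Import Order.TTheory.

Local Open Scope classical_set_scope.
Local Open Scope order_scope.

Section OperatorResiduatedTheory.
Context {dP dQ : Order.disp_t} {P : porderType dP} {Q : porderType dQ}.
Context {f : P -> Q} {fs : Q -> set P} (hf : operator_residuated f fs).

(** The pair behaves like a Galois connection whose right adjoint is set-valued. Reflexivity, read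
    on either side of the equivalence, yields a unit and a counit; the unit also makes [f] monotone.
    As usual for adjunctions, all four relations follow from these. *)

Lemma operator_residuatedP x y : f x <= y <-> exists2 z, fs y z & x <= z.
Proof.
case: hf => _ /(_ x y) ->; split; first exact.
by move=> fsy_x _ ->.
Qed.

Lemma operator_residuated_unit x : exists2 z, fs (f x) z & x <= z.
Proof. exact/operator_residuatedP. Qed.

Lemma operator_residuated_counit {x y} : fs y x -> f x <= y.
Proof. by move=> fsyx; apply/operator_residuatedP; exists x. Qed.

(** Some [z] in [fs (f y)] lies above [y], hence above [x], and adjointness turns this into
    [f x <= f y]. *)
Lemma operator_residuated_homo : {homo f : x y / x <= y}.
Proof.
move=> x y le_xy; apply/operator_residuatedP.
have [z fz le_yz] := operator_residuated_unit y.
by exists z => //; apply: le_trans le_yz.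
Qed.

End OperatorResiduatedTheory.

Theorem theorem2p6 (dP dQ : Order.disp_t) (P : porderType dP) (Q : porderType dQ)
    (f : P -> Q) (fs : Q -> set P) (hf : operator_residuated f fs)
    (a : P) (b : Q) :
  (set_le1 [set f a] (f @` fs (f a)) /\
   set_le (f @` fs (f a)) [set f a]) /\
  (set_le1 (fs b) (set_ext fs (f @` fs b)) /\
   set_le1 (set_ext fs (f @` fs b)) (fs b)).
Proof.
split; split.
- move=> _ ->; have [z fz le_az] := operator_residuated_unit hf a.
  by exists (f z); [exists z | apply: (operator_residuated_homo hf)].
- by move=> _ _ [x fx <-] ->; apply: (operator_residuated_counit hf).
- move=> x fsbx; have [z fz le_xz] := operator_residuated_unit hf x.
  by exists z => //; exists (f x) => //; exists x.
(* Here [x] need not lie below [y]. By adjointness it suffices that [f x <= b], which two counits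
   give through [f y]. *)
- move=> x [_ [y fsby <-] fsx]; apply/(operator_residuatedP hf).
  exact: le_trans (operator_residuated_counit hf fsx)
    (operator_residuated_counit hf fsby).
Qed.
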